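(* Let $n \geq 1$ be an integer and let $\theta \geq 0$. If $h \in \mathcal{H}^\theta(\mathbf{R}^n)$, i.e. if $h$ is a (fully supported) majorizing kernel with exponent $\theta$ on $\mathbf{R}^n$, then $\theta < n/2$.
   Context: A majorizing kernel with exponent $\theta \geq 0$ on $\mathbf{R}^n$ is a tempered function (a measurable function that is also a tempered distribution) $h : \mathbf{R}^n \to (0,\infty]$ such that: (i) there is a constant $B > 0$ with $h*h(\xi) = \int_{\mathbf{R}^n} h(\xi-\eta)h(\eta)\,d\eta \leq B|\xi|^\theta h(\xi)$ for all $\xi \in \mathbf{R}^n$; (ii) $h^{-1}(\infty)$ has $n$-dimensional Lebesgue measure zero. In (i) the value $|\xi|^\theta h(\xi)$ is taken to be $\infty$ whenever $h(\xi)=\infty$ (including at $\xi = 0$), and $|0|^0=1$. $\mathcal{H}^\theta(\mathbf{R}^n)$ denotes the set of all majorizing kernels with exponent $\theta$ on $\mathbf{R}^n$. *)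

(* Defs.v *)
From HB Require Import structures.
From mathcomp Require Import all_boot all_order all_algebra.
From mathcomp Require Import all_classical all_reals all_analysis.
From mathcomp Require Import measurable_realfun.

Set Implicit Arguments.
Unset Strict Implicit.
Unset Printing Implicit Defensive.
Import Order.TTheory GRing.Theory Num.Theory.
Import numFieldNormedType.Exports.

Local Open Scope classical_set_scope.
Local Open Scope ring_scope.

Section borel_rV.
Variables (R : realType) (n : nat).

(* 'rV[R]_n with the sigma-algebra generated by the coordinate projections,
   as for n.-tuple; over R this is the Borel sigma-algebra. *)
Definition borel_rV : Type := 'rV[R]_n.

Definition rV_coord (i : 'I_n) (x : borel_rV) : measurableTypeR R := x ord0 i.

HB.instance Definition _ := Pointed.copy borel_rV 'rV[R]_n.

Definition borel_rV_display : measure_display.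
Proof. exact: (measure_tuple_display default_measure_display). Qed.

Let borel_rV0 : g_sigma_preimage rV_coord set0.
Proof. exact: sigma_algebra0. Qed.

Let borel_rVC A : g_sigma_preimage rV_coord A ->
  g_sigma_preimage rV_coord (~` A).
Proof. exact: sigma_algebraC. Qed.

Let borel_rV_bigcup (F : (set borel_rV)^nat) :
  (forall i, g_sigma_preimage rV_coord (F i)) ->
  g_sigma_preimage rV_coord (\bigcup_i F i).
Proof. exact: sigma_algebra_bigcup. Qed.

HB.instance Definition _ := @isMeasurable.Build borel_rV_display borel_rV
  (g_sigma_preimage rV_coord) borel_rV0 borel_rVC borel_rV_bigcup.

Lemma measurable_rV_coord (i : 'I_n) : measurable_fun setT (rV_coord i).
Proof.
move=> _ Y mY; rewrite setTI; apply: sub_sigma_algebra => /=.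
rewrite -bigcup_seq/=; exists i => /=; first by rewrite mem_index_enum.
by exists Y => //; rewrite setTI.
Qed.

Lemma measurable_fun_rV d (T : measurableType d) (f : T -> borel_rV) :
  (forall i, measurable_fun setT (rV_coord i \o f)) -> measurable_fun setT f.
Proof.
move=> mf _ A mA; rewrite setTI.
pose G := [set B : set borel_rV | measurable (f @^-1` B)].
suff : g_sigma_preimage rV_coord `<=` G by exact.
apply: smallest_sub.
  split => /=; rewrite /G /=.
  - by rewrite preimage_set0.
  - by move=> B mB; rewrite setTD preimage_setC; exact: measurableC.
  - by move=> F mF; rewrite preimage_bigcup; exact: bigcupT_measurable.
rewrite -bigcup_seq; apply: bigcup_sub => i _ _ [B mB <-].
by rewrite /G /= setTI -comp_preimage -[X in measurable X]setTI; exact: mf.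
Qed.

End borel_rV.

Section lebesgue_measure_step.
Variables (R : realType) (n : nat).

Definition rV_cons (p : measurableTypeR R * borel_rV R n) : borel_rV R n.+1 :=
  \row_i oapp (p.2 ord0) p.1 (unlift ord0 i).

Definition rV_uncons (x : borel_rV R n.+1) : measurableTypeR R * borel_rV R n :=
  (x ord0 ord0, \row_j x ord0 (lift ord0 j)).

Lemma rV_consK : cancel rV_cons rV_uncons.
Proof.
move=> [a v]; congr (_, _); first by rewrite mxE unlift_none.
by apply/rowP => j; rewrite !mxE liftK.
Qed.

Lemma measurable_rV_cons : measurable_fun setT rV_cons.
Proof.
apply: measurable_fun_rV => i.
case: (unliftP ord0 i) => [j ->|->].
- rewrite (_ : _ \o _ = @rV_coord R n j \o snd).
    by apply: measurableT_comp => //; exact: measurable_rV_coord.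
  by apply/funext => p /=; rewrite /rV_coord mxE liftK.
- rewrite (_ : _ \o _ = fst)//.
  by apply/funext => p /=; rewrite /rV_coord mxE unlift_none.
Qed.

Lemma measurable_rV_uncons : measurable_fun setT rV_uncons.
Proof.
apply/measurable_fun_pairP; split.
  exact: (@measurable_rV_coord R n.+1 ord0).
apply: measurable_fun_rV => j.
rewrite (_ : _ \o _ = @rV_coord R n.+1 (lift ord0 j)).
  exact: measurable_rV_coord.
by apply/funext => x /=; rewrite /rV_coord mxE.
Qed.

Variable mu : {sigma_finite_measure set (borel_rV R n) -> \bar R}.

Definition lebesgue_step : set (borel_rV R n.+1) -> \bar R :=
  pushforward (@lebesgue_measure R \x mu)%E rV_cons.

Let lebesgue_step0 : lebesgue_step set0 = 0%E.
Proof. by rewrite /lebesgue_step /pushforward preimage_set0 measure0. Qed.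

Let lebesgue_step_ge0 A : (0 <= lebesgue_step A)%E.
Proof. by rewrite /lebesgue_step /pushforward; exact: measure_ge0. Qed.

Let lebesgue_step_sigma_additive : semi_sigma_additive lebesgue_step.
Proof.
move=> F mF tF mUF; rewrite /lebesgue_step /pushforward preimage_bigcup.
apply: measure_semi_sigma_additive.
- by move=> k; rewrite -[X in measurable X]setTI; exact: measurable_rV_cons.
- apply/trivIsetP => /= i j _ _ ij; rewrite -preimage_setI.
  by move/trivIsetP : tF => /(_ _ _ _ _ ij) ->//; rewrite preimage_set0.
- rewrite -preimage_bigcup -[X in measurable X]setTI.
  exact: measurable_rV_cons.
Qed.

HB.instance Definition _ := isMeasure.Build _ _ _ lebesgue_step
  lebesgue_step0 lebesgue_step_ge0 lebesgue_step_sigma_additive.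

Let lebesgue_step_sigma_finite : sigma_finite setT lebesgue_step.
Proof.
have /sigma_finiteP[F [FT ndF Foo]] := sigma_finiteT (@lebesgue_measure R).
have /sigma_finiteP[G [GT ndG Goo]] := sigma_finiteT mu.
exists (fun k => rV_uncons @^-1` (F k `*` G k)).
  rewrite -preimage_bigcup (_ : \bigcup_k _ = setT) ?preimage_setT//.
  rewrite -subTset => -[x y] _.
  have [k _ Fkx] : (\bigcup_k F k) x by rewrite -FT.
  have [l _ Gly] : (\bigcup_k G k) y by rewrite -GT.
  exists (maxn k l) => //; split => /=.
  - by move: x Fkx; exact/subsetPset/ndF/leq_maxl.
  - by move: y Gly; exact/subsetPset/ndG/leq_maxr.
move=> k; have [mFk Fkoo] := Foo k; have [mGk Gkoo] := Goo k; split.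
  rewrite -[X in measurable X]setTI.
  by apply: measurable_rV_uncons => //; exact: measurableX.
rewrite /lebesgue_step /pushforward -comp_preimage.
rewrite (_ : _ \o _ = id); last by apply/funext => p; exact: rV_consK.
by rewrite product_measure1E// lte_mul_pinfty// ge0_fin_numE.
Qed.

HB.instance Definition _ := Measure_isSigmaFinite.Build _ _ _ lebesgue_step
  lebesgue_step_sigma_finite.

End lebesgue_measure_step.

(* n-fold product of the one-dimensional Lebesgue measure, on Borel sets *)
Fixpoint lebesgue_borel (R : realType) (n : nat) :
    {sigma_finite_measure set (borel_rV R n) -> \bar R} :=
  match n with
  | 0 => @dirac _ (borel_rV R 0) (0 : 'rV[R]_0) R
  | n'.+1 => lebesgue_step (lebesgue_borel R n')
  end.

Section lebesgue_rV.
Variables (R : realType) (n : nat).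

(* 'rV[R]_n with the (Caratheodory) sigma-algebra of Lebesgue measurable sets *)
Definition lebesgue_rV : Type := caratheodory_type (mu_ext (lebesgue_borel R n)).

HB.instance Definition _ := Measurable.copy lebesgue_rV
  (caratheodory_type (mu_ext (lebesgue_borel R n))).

Definition lebesgue : {measure set lebesgue_rV -> \bar R} :=
  @completed_measure_extension _ _ _ (lebesgue_borel R n).

Definition lebesgue_integral (f : 'rV[R]_n -> \bar R) : \bar R :=
  (\int[lebesgue]_x f x)%E.

End lebesgue_rV.

Section schwartz.
Variables (R : realType) (n : nat).
Implicit Types (f phi psi : 'rV[R]_n -> R) (s : seq 'I_n) (a : 'I_n -> nat).

Definition pderive (i : 'I_n) f : 'rV[R]_n -> R := 'D_(delta_mx ord0 i) f.

(* iterated partial derivative in the directions listed in s *)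
Definition pderives s f : 'rV[R]_n -> R := foldr pderive f s.

Definition smooth f := forall s,
  continuous (pderives s f) /\
  forall i x, derivable (pderives s f) x (delta_mx ord0 i).

Definition monomial a (x : 'rV[R]_n) : R := \prod_(i < n) x ord0 i ^+ a i.

Definition schwartz_seminorm a s f : \bar R :=
  ereal_sup [set (`|monomial a x * pderives s f x|)%:E | x in setT].

Definition schwartz : set ('rV[R]_n -> R) :=
  [set f | smooth f /\ forall a s, (schwartz_seminorm a s f < +oo)%E].

(* Continuity is for the locally convex topology of the Schwartz space, with
   the neighborhoods of phi given by finitely many seminorms. *)
Definition tempered_distribution (T : ('rV[R]_n -> R) -> R) :=
  (forall c phi psi, schwartz phi -> schwartz psi ->
    T (fun x => c * phi x + psi x) = c * T phi + T psi) /\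
  (forall phi, schwartz phi -> forall e : R, 0 < e ->
    exists N : nat, exists2 d : R, 0 < d &
      forall psi, schwartz psi ->
        (forall a s, (\sum_(i < n) a i <= N)%N -> (size s <= N)%N ->
          (schwartz_seminorm a s (fun x => psi x - phi x)%R < d%:E)%E) ->
        `|T psi - T phi| < e).

Definition tempered_function (h : 'rV[R]_n -> \bar R) :=
  [/\ measurable_fun setT (h : lebesgue_rV R n -> \bar R),
      (forall phi, schwartz phi ->
        (@lebesgue R n).-integrable setT
          (fun x => h x * (phi x)%:E)%E) &
      tempered_distribution
        (fun phi => fine (lebesgue_integral (fun x => h x * (phi x)%:E)%E))].

End schwartz.

Section majorizing_kernel.
Variables (R : realType) (n : nat).
Implicit Types (h g : 'rV[R]_n -> \bar R) (xi : 'rV[R]_n).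

(* the library norm on 'rV[R]_n is the sup norm *)
Definition euclidean_norm xi : R := Num.sqrt (\sum_(i < n) xi ord0 i ^+ 2).

Definition convolution h g xi : \bar R :=
  lebesgue_integral (fun eta => (h (xi - eta)%R * g eta)%E).

(* The case split is needed at xi = 0, as 0 * +oo = 0 in \bar R. *)
Definition weighted (theta : R) h xi : \bar R :=
  if h xi == +oo%E then +oo%E else ((euclidean_norm xi `^ theta)%:E * h xi)%E.

Definition majorizing_kernel (theta : R) : set ('rV[R]_n -> \bar R) :=
  [set h | [/\ forall xi, (0 < h xi)%E,
               tempered_function h,
               exists2 B : R, 0 < B &
                 forall xi, (convolution h h xi <= B%:E * weighted theta h xi)%E &
               lebesgue R n (h @^-1` [set +oo%E]) = 0%E]].

End majorizing_kernel.

(* Main.v *)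
Require Import Defs.
From mathcomp Require Import all_boot all_order all_algebra.
From mathcomp Require Import all_classical all_reals all_analysis.
From mathcomp Require Import measurable_realfun ring lra.
Import Order.TTheory GRing.Theory Num.Theory.
Local Open Scope ring_scope.
Local Open Scope classical_set_scope.

(** Write the kernel inequality as [h * h <= B |xi|^theta h] and suppose that
    [theta >= n / 2].

    Since [h] is positive everywhere, [h * h] is bounded below by a positive
    constant near the origin ([convolution_bounded_below]), and the kernel
    inequality turns this into [h >= c |xi|^-theta] there.  Inserting this
    bound into the convolution, whose integrand becomes of order
    [|x|^-(2 theta)] with [2 theta >= n], shows that [h * h] tends to infinity
    at the origin ([convolution_unbounded]).  So [h >= K |xi|^-theta] near the
    origin for every [K].

    On the other hand such a [K] is bounded ([kernel_exponent_lt]).  Take a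
    small cube of radius [r] and let [m] be the mass of [h] on it.  For [xi] in
    this cube, [h * h (xi)] is at least of order [K r^-theta m], so [K m] is at
    most of order [r^(2 theta) h (xi)]; integration over the cube gives [K m]
    at most of order [r^(2 theta - n) m], and [m] is positive and finite.

    All estimates are made on sup-norm cubes.  The measure theory they require
    is the volume of cubes ([lebesgue_cube]) and the invariance of Lebesgue
    measure and measurability under [x |-> xi - x] ([lebesgue_reflection],
    [measurable_reflection_preimage]). *)

(** * Invariance of Lebesgue measure under point reflections *)

Section reflection_borel.
Context {R : realType}.

Definition reflection {n} (xi x : borel_rV R n) : borel_rV R n :=
  ((xi : 'rV[R]_n) - (x : 'rV[R]_n)).

Lemma measurable_reflection n (xi : borel_rV R n) :
  measurable_fun setT (reflection xi).
Proof.
apply: measurable_fun_rV => i.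
rewrite (_ : _ \o _ = fun x => rV_coord i xi - rV_coord i x); last first.
  by apply/funext => x; rewrite /= /rV_coord !mxE.
by apply: measurable_funB => //; exact: measurable_rV_coord.
Qed.

Let reflect1 (c x : measurableTypeR R) : measurableTypeR R := c - x.

Let measurable_reflect1 c : measurable_fun setT (reflect1 c).
Proof. exact: measurable_funB. Qed.

Lemma lebesgue_measure_reflection (c : R) (A : set (measurableTypeR R)) :
  measurable A ->
  lebesgue_measure (reflect1 c @^-1` A) = lebesgue_measure A.
Proof.
move=> mA; rewrite -[LHS]/(pushforward lebesgue_measure (reflect1 c) A).
apply/esym/lebesgue_measure_unique => //.
move=> _ [[a b]] _ <-.
rewrite -[RHS]/(lebesgue_measure (reflect1 c @^-1` `]a, b]%classic)).
have -> : reflect1 c @^-1` `]a, b]%classic = `[c - b, c - a[%classic.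
  by apply/seteqP; split => x /=; rewrite /reflect1 !in_itv/=; lra.
by rewrite !lebesgue_measure_itv/= !lte_fin; case: ifPn => ab;
  case: ifPn => ab' //; rewrite -?EFinB; try congr (_%:E); lra.
Qed.

(** Induction on the dimension: through [rV_cons] the reflection splits as a
    reflection of the line times a reflection in one dimension less, so the
    pushforward agrees with the product measure on rectangles. *)
Lemma lebesgue_borel_reflection n (xi : borel_rV R n) (A : set (borel_rV R n)) :
  measurable A ->
  lebesgue_borel R n (reflection xi @^-1` A) = lebesgue_borel R n A.
Proof.
elim: n xi A => [xi A mA|n IH xi A mA].
  congr (lebesgue_borel _ _ _); apply/seteqP; split=> x;
    by rewrite /preimage /= (_ : reflection xi x = x)//; apply/rowP => -[].
rewrite /= /lebesgue_step /pushforward.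
pose xi' := (rV_uncons xi).2.
pose phi0 (p : measurableTypeR R * borel_rV R n) :
  measurableTypeR R * borel_rV R n :=
  (reflect1 (xi ord0 ord0) p.1, reflection xi' p.2).
have mphi0 : measurable_fun setT phi0.
  apply/measurable_fun_pairP; split.
    exact: (measurableT_comp (measurable_reflect1 _) measurable_fst).
  rewrite (_ : _ \o _ = reflection xi' \o snd)//.
  by apply: measurableT_comp => //; exact: measurable_reflection.
have consE p : reflection xi (rV_cons p) = rV_cons (phi0 p).
  apply/rowP => i; rewrite /reflection !mxE.
  by case: (unliftP ord0 i) => [j|] -> /=; rewrite ?liftK ?unlift_none /= ?mxE.
have preimE : @rV_cons R n @^-1` (reflection xi @^-1` A) =
    phi0 @^-1` (@rV_cons R n @^-1` A).
  by apply/seteqP; split=> p; rewrite /preimage/= consE.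
have mcA : measurable (@rV_cons R n @^-1` A).
  by rewrite -[X in measurable X]setTI; exact: measurable_rV_cons.
rewrite preimE.
rewrite -[LHS]/(pushforward (lebesgue_measure \x lebesgue_borel R n)%E phi0 _).
apply/esym/product_measure_unique => //.
move=> B C mB mC.
rewrite -[LHS]/((lebesgue_measure \x lebesgue_borel R n)%E
  ((reflect1 (xi ord0 ord0) @^-1` B) `*` (reflection xi' @^-1` C))).
rewrite product_measure1E.
- congr (_ * _)%E; first exact: lebesgue_measure_reflection.
  exact: IH.
- by rewrite -[X in measurable X]setTI; exact: measurable_reflect1.
- by rewrite -[X in measurable X]setTI; exact: measurable_reflection.
Qed.

End reflection_borel.

Section reflection.
Context {R : realType} {n : nat}.
Implicit Types xi : 'rV[R]_n.
Local Notation mu := (@lebesgue R n).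

Lemma reflection_preimageK xi (A : set 'rV[R]_n) :
  (fun x => xi - x) @^-1` ((fun x => xi - x) @^-1` A) = A.
Proof.
suff e x : xi - (xi - x) = x by apply/seteqP; split => x; rewrite /preimage/= e.
by rewrite opprB addrC subrK.
Qed.

Lemma reflection_preimageI xi (X A : set 'rV[R]_n) :
  (fun x => xi - x) @^-1` ((fun x => xi - x) @^-1` X `&` A) =
  X `&` (fun x => xi - x) @^-1` A.
Proof. by rewrite preimage_setI reflection_preimageK. Qed.

Lemma lebesgue_borelE (A : set (borel_rV R n)) :
  measurable A -> mu A = lebesgue_borel R n A.
Proof. exact: measurable_mu_extE. Qed.

Lemma measurable_lebesgue_rV (A : set (borel_rV R n)) :
  measurable A -> measurable (A : set (lebesgue_rV R n)).
Proof. exact: caratheodory_measurable_mu_ext. Qed.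

(** The outer measure is computed from Borel covers, and a reflection carries
    covers of a set to covers of its preimage of the same total measure.  The
    set is arbitrary, so this also transports Caratheodory measurability. *)
Lemma lebesgue_reflection xi (A : set (lebesgue_rV R n)) :
  mu ((fun x => xi - x) @^-1` A) = mu A.
Proof.
suff le B : (mu ((fun x => xi - x)%R @^-1` B) <= mu B)%E.
  apply/eqP; rewrite eq_le le/=.
  by have := le ((fun x => xi - x) @^-1` A); rewrite reflection_preimageK.
apply: le_ereal_inf_tmp => _ [F [mF BF] <-].
apply: ereal_inf_lbound; exists (fun k => reflection xi @^-1` F k).
  split=> [k|x /BF [k _ Fk]]; last by exists k.
  by rewrite -[X in measurable X]setTI; exact: measurable_reflection.
by apply: eq_eseriesr => k _; exact: lebesgue_borel_reflection.
Qed.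

Lemma measurable_reflection_preimage xi (A : set (lebesgue_rV R n)) :
  measurable A -> measurable ((fun x => xi - x) @^-1` A : set (lebesgue_rV R n)).
Proof.
move=> mA; have {}mA : mu.-caratheodory A by exact: mA.
suff : mu.-caratheodory ((fun x => xi - x) @^-1` A) by exact.
move=> X; rewrite -[LHS](lebesgue_reflection xi) mA.
congr (_ + _)%E; rewrite -[LHS](lebesgue_reflection xi); congr (mu _);
  exact: reflection_preimageI.
Qed.

End reflection.

(** * Cubes *)

Section cube.
Context {R : realType}.

(** Closed balls of the sup norm centred at the origin.  They stand in for
    Euclidean balls: their measure is immediate, and the two norms differ only
    by the factor [Num.sqrt n]. *)
Definition cube n (s : R) : set 'rV[R]_n :=
  [set x | forall i, (`|x ord0 i| <= s)%R].

(** The recursion that matches the one defining [lebesgue_borel]. *)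
Lemma cubeS n s :
  cube n.+1 s = @rV_uncons R n @^-1` (`[- s, s]%classic `*` cube n s).
Proof.
apply/seteqP; split => x; rewrite /cube /preimage /=.
  move=> xs; split=> [|j]; last by rewrite mxE.
  by rewrite in_itv/= -ler_norml.
rewrite in_itv/= -ler_norml => -[x0 xs] i.
by case: (unliftP ord0 i) => [j|] ->//; have := xs j; rewrite mxE.
Qed.

Let measurable_cube_borel n s : measurable (cube n s : set (borel_rV R n)).
Proof.
elim: n => [|n IH].
  by rewrite (_ : cube 0 s = setT)//; apply/seteqP; split => // x _ [].
rewrite cubeS -[X in measurable X]setTI.
by apply: measurable_rV_uncons => //; exact: measurableX.
Qed.

Lemma measurable_cube n s : measurable (cube n s : set (lebesgue_rV R n)).
Proof. apply: measurable_lebesgue_rV; exact: measurable_cube_borel. Qed.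

Lemma lebesgue_cube n s : (0 <= s)%R ->
  @lebesgue R n (cube n s) = ((s *+ 2) ^+ n)%:E.
Proof.
move=> s0; rewrite lebesgue_borelE//; elim: n => [|n IH].
  by rewrite /= diracE expr0 mem_set// => -[].
rewrite /= /lebesgue_step /pushforward cubeS -comp_preimage.
rewrite (_ : _ \o _ = id); last by apply/funext => p; exact: rV_consK.
rewrite product_measure1E//; last exact: measurable_cube_borel.
rewrite IH -[X in (X * _)%E]/(lebesgue_measure `[- s, s]%classic).
rewrite lebesgue_measure_itv/= lte_fin.
rewrite exprS EFinM; case: ifPn => [_|ss]; first by rewrite -EFinB opprK.
have -> : s = 0%R by lra.
by rewrite mul0rn.
Qed.

End cube.

Section cube_geometry.
Context {R : realType} {n : nat}.
Implicit Types (s t : R) (x y : 'rV[R]_n).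

Lemma le_cube s t : s <= t -> cube n s `<=` cube n t.
Proof. by move=> st x xs i; exact: le_trans (xs i) st. Qed.

Lemma cubeB s t x y : cube n s x -> cube n t y -> cube n (s + t) (x - y).
Proof.
move=> xs yt i; rewrite !mxE; apply: le_trans (ler_normB _ _) _.
exact: lerD.
Qed.

Lemma euclidean_norm_cube s x : 0 <= s -> cube n s x ->
  euclidean_norm x <= Num.sqrt n%:R * s.
Proof.
move=> s0 xs; rewrite -(ger0_norm s0) -sqrtr_sqr -sqrtrM ?ler0n//.
rewrite ler_wsqrtr// mulr_natl -[n in leRHS]card_ord -sumr_const.
apply: ler_sum => i _; rewrite -real_normK ?num_real//.
by rewrite lerXn2r// ?nnegrE.
Qed.

End cube_geometry.

(** * Weighted sums of indicators *)

Lemma sum_geometric_le (R : realDomainType) (u : nat -> R) k :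
  (forall i, 0 <= u i) -> (forall i, 2 * u i <= u i.+1) ->
  \sum_(i < k.+1) u i <= 2 * u k.
Proof.
move=> u0 uS; elim: k => [|k IH]; first by rewrite big_ord1; have := u0 0%N; lra.
by rewrite big_ord_recr /=; have := uS k; lra.
Qed.

(** A majorant of the largest active weight majorizes the whole sum up to a
    factor 2, by geometric growth.  With nested sets this gives lower
    estimates for integrals without cutting the domain into disjoint shells. *)
Lemma sum_indic_geometric_le (R : realType) (T : Type) (Q : nat -> set T)
    (u : nat -> R) (g : \bar R) k x :
  (forall i, 0 <= u i) -> (forall i, 2 * u i <= u i.+1) -> (0 <= g)%E ->
  (forall i, (i < k)%N -> Q i x -> ((u i)%:E <= g)%E) ->
  ((\sum_(i < k) u i * \1_(Q i) x)%:E <= 2%:E * g)%E.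
Proof.
move=> u0 uS; case: g => [g| |//]; last first.
  by rewrite gt0_muley ?lte_fin ?leey.
rewrite -EFinM !lee_fin => g0; elim: k => [|k IH] ug.
  by rewrite big_ord0 mulr_ge0.
have [Qkx|nQkx] := pselect (Q k x); last first.
  rewrite big_ord_recr/= indicE memNset// mulr0 addr0.
  by apply: IH => i ik; apply: ug; rewrite ltnS ltnW.
have := ug k (ltnSn k) Qkx; rewrite lee_fin => ukg.
apply: (@le_trans _ _ (2 * u k)); last by rewrite ler_pM2l.
apply: le_trans (sum_geometric_le _ u k u0 uS).
by apply: ler_sum => i _; rewrite ler_piMr// indicE lern1 leq_b1.
Qed.

(** * Lower bounds for majorizing kernels *)

Section kernel.
Context {R : realType} {n : nat}.
Variables (theta B : R) (h : 'rV[R]_n -> \bar R).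
Hypotheses (n_gt0 : (0 < n)%N) (theta_ge0 : 0 <= theta) (B_gt0 : 0 < B).
Hypothesis h_gt0 : forall xi, (0 < h xi)%E.
Hypothesis mh : measurable_fun setT (h : lebesgue_rV R n -> \bar R).
Hypothesis hh : forall xi, (convolution h h xi <= B%:E * weighted theta h xi)%E.
Hypothesis h_infty : lebesgue R n (h @^-1` [set +oo%E]) = 0%E.
Local Open Scope ereal_scope.
Local Notation mu := (lebesgue R n).
Local Notation Q := (cube n).

Let D : R := B * (Num.sqrt n%:R `^ theta).

Let D_gt0 : (0 < D)%R.
Proof. by rewrite mulr_gt0// powR_gt0// sqrtr_gt0 ltr0n. Qed.

Let Ds_gt0 s : (0 < s)%R -> (0 < D * s `^ theta)%R.
Proof. by move=> s0; rewrite mulr_gt0 ?D_gt0 ?powR_gt0. Qed.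

Let h_ge0 xi : 0 <= h xi. Proof. exact: ltW. Qed.

(** The form in which the kernel inequality is used.  It has no case
    distinction: where [h] is infinite, in particular possibly at the origin,
    the right-hand side is infinite because [s] is positive. *)
Lemma kernel_bound s xi : (0 < s)%R -> Q s xi ->
  convolution h h xi <= (D * s `^ theta)%:E * h xi.
Proof.
move=> s0 xis; apply: le_trans (hh xi) _; rewrite /weighted.
have ns0 : (0 < Num.sqrt n%:R * s)%R by rewrite mulr_gt0// sqrtr_gt0 ltr0n.
case: ifPn => [/eqP ->|_].
  by rewrite !gt0_muley ?lte_fin// mulr_gt0// powR_gt0.
rewrite /D -mulrA -powRM ?sqrtr_ge0 ?(ltW s0)// EFinM -muleA.
rewrite lee_pmul2l// lee_wpmul2r//.
rewrite lee_fin ge0_ler_powR ?nnegrE ?sqrtr_ge0 ?(ltW ns0)//.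
by apply: euclidean_norm_cube => //; exact: ltW.
Qed.

Let measurable_h_reflect xi :
  measurable_fun setT ((fun eta => h (xi - eta)%R) : lebesgue_rV R n -> \bar R).
Proof.
move=> _ Y mY; rewrite setTI.
rewrite (_ : _ @^-1` _ = (fun x => xi - x)%R @^-1` (h @^-1` Y))//.
by apply: measurable_reflection_preimage; rewrite -[X in measurable X]setTI; exact: mh.
Qed.

Lemma le_convolution xi (A : set (lebesgue_rV R n)) (f : lebesgue_rV R n -> \bar R) :
  measurable A -> measurable_fun A f ->
  (forall x, A x -> 0 <= f x <= h (xi - x)%R * h x) ->
  \int[mu]_(x in A) f x <= convolution h h xi.
Proof.
move=> mA mf fh.
have mc : measurable_fun setT
  ((fun eta => h (xi - eta)%R * h eta) : lebesgue_rV R n -> \bar R).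
  exact: emeasurable_funM.
apply: (@le_trans _ _ (\int[mu]_(x in A) (h (xi - x)%R * h x))).
  apply: ge0_le_integral.
  - exact: mA.
  - by move=> x /fh/andP[].
  - exact: mf.
  - exact: measurable_funS mc.
  - by move=> x /fh/andP[].
apply: ge0_subset_integral => //.
by move=> x _; exact: mule_ge0.
Qed.

(** As [h] is positive, [h >= e] on all of the cube of radius 2 but a set
    [F j] of small measure.  For [xi] in the unit cube, [xi - x] stays in the
    cube of radius 2 when [x] runs through the unit cube, so both factors of
    the integrand are at least [e] off [F j] and its reflection. *)
Lemma convolution_bounded_below :
  exists2 c : R, (0 < c)%R & forall xi, Q 1 xi -> c%:E <= convolution h h xi.
Proof.
(* The exceptional sets decrease to the empty set, hence have small measure. *)
pose F j : set (lebesgue_rV R n) := Q 2 `&` [set x | h x < (j.+1%:R^-1)%:E].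
have mF j : measurable (F j).
  by apply: emeasurable_fun_infty_o; [exact: measurable_cube|exact: measurable_funS mh].
have F0 : \bigcap_j F j = set0.
  apply/seteqP; split => // x Fx.
  have : h x <= 0.
    apply/lee_addgt0Pr => e e0; rewrite add0e.
    have [_ /ltW/le_trans] := Fx (Num.truncn e^-1) I; apply.
    by rewrite lee_fin invf_ple ?posrE// ltW// truncnS_gt.
  by rewrite leNgt h_gt0.
have Fcvg : mu \o F @ \oo --> 0.
  rewrite -(measure0 mu) -F0; apply: nonincreasing_cvg_mu => //.
  - apply: (@le_lt_trans _ _ (mu (Q 2))).
      by apply: le_measure; rewrite ?inE//; [exact: measurable_cube|exact: subIsetl].
    by rewrite lebesgue_cube// ltry.
  - by rewrite F0.
  - move=> j k jk; apply/subsetPset => x [Qx hx]; split=> //.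
    apply: lt_le_trans hx _.
    by rewrite lee_fin lef_pV2 ?posrE// ler_nat.
have [j Fj] : exists j, mu (F j) < (4^-1)%:E.
  apply: contrapT => /forallNP nF.
  suff : (4^-1)%:E <= (0 : \bar R) by rewrite lee_fin; lra.
  rewrite -(cvg_lim _ Fcvg)//; apply: lime_ge; first by apply/cvg_ex; exists 0.
  by apply: nearW => j /=; rewrite leNgt; apply/negP/nF.
set e := (j.+1%:R^-1 : R)%R.
have e0 : (0 < e)%R by rewrite invr_gt0.
exists (e * e / 2)%R => [|xi xi1]; first by rewrite divr_gt0// mulr_gt0.
pose rF : set (lebesgue_rV R n) := (fun x => xi - x)%R @^-1` F j.
have mrF : measurable rF by exact: measurable_reflection_preimage.
pose G : set (lebesgue_rV R n) := Q 1 `\` (F j `|` rF).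
have mG : measurable G.
  by apply: measurableD; [exact: measurable_cube|exact: measurableU].
have muG : (2^-1)%:E <= mu G.
  have : mu (Q 1) <= mu G + (mu (F j) + mu rF).
    apply: (@le_trans _ _ (mu (G `|` (F j `|` rF)))).
      apply: le_measure; rewrite ?inE.
      - exact: measurable_cube.
      - by do 2 apply: measurableU => //.
      - move=> x Qx; have [?|?] := pselect ((F j `|` rF) x); first by right.
        by left; split.
    apply: le_trans (measureU2 _ _ _) _ => //; first exact: measurableU.
    by rewrite leeD2l// measureU2.
  rewrite lebesgue_reflection lebesgue_cube//.
  have F_fin : mu (F j) \is a fin_num.
    by rewrite ge0_fin_numE// (lt_trans Fj)// ltry.
  move: Fj; rewrite -(fineK F_fin) lte_fin => Fj.
  case: (mu G) (measure_ge0 mu G) => [g _| _ _|//]; last by rewrite leey.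
  rewrite -!EFinD !lee_fin.
  have : (1 <= (1 *+ 2 : R) ^+ n)%R by rewrite exprn_ege1// mulr2n; lra.
  lra.
apply: (@le_trans _ _ (\int[mu]_(x in G) cst (e * e)%:E x)).
  by rewrite integral_cst// EFinM lee_pmul2l// lte_fin mulr_gt0.
apply: le_convolution => // x [Qx /not_orP[Fx rFx]].
apply/andP; split; first by rewrite lee_fin mulr_ge0// ltW.
rewrite /cst EFinM; apply: lee_pmul => //; rewrite ?lee_fin ?(ltW e0)// leNgt.
- apply/negP => hx; apply: rFx; split=> //=.
  by rewrite -[2%R]/(1 + 1)%R; exact: cubeB.
- apply/negP => hx; apply: Fx; split=> //.
  by apply: le_cube Qx; lra.
Qed.

Lemma kernel_lower_bound c s xi : (0 < s)%R -> Q s xi ->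
  c%:E <= convolution h h xi -> (c / (D * s `^ theta))%:E <= h xi.
Proof.
move=> s0 xis ch; rewrite mulrC EFinM lee_pdivrMl ?Ds_gt0//.
exact: le_trans ch (kernel_bound _ _ s0 xis).
Qed.

Lemma powR_sqr_le (s : R) : (n%:R / 2 <= theta)%R -> (0 < s <= 1)%R ->
  (s `^ theta * s `^ theta <= s ^+ n)%R.
Proof.
move=> ntheta /andP[s0 s1].
rewrite -powRD; last by rewrite (gt_eqF s0) implybT.
by rewrite -powR_mulrn ?(ltW s0)// ger_powR ?s0//; lra.
Qed.

(** By [convolution_bounded_below] and the kernel inequality, [h] dominates
    [|x|^-theta] near the origin.  On each cube of radius [2^-(i+1)] containing
    [xi] the integrand is then at least a constant times the [-2 theta]-th
    power of the radius, hence at least the inverse volume up to a constant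
    since [2 theta >= n]: every dyadic scale above that of [xi] contributes a
    fixed amount.  This is the logarithmic divergence of the integral of
    [|x|^-n]. *)
Lemma convolution_unbounded : (n%:R / 2 <= theta)%R ->
  exists2 c : R, (0 < c)%R &
    forall k xi, Q (2^-1 ^+ k) xi -> (c * k%:R)%:E <= convolution h h xi.
Proof.
move=> ntheta; have [c c0 hc] := convolution_bounded_below.
(* [c / D] bounds [t^theta h] below on the cube of radius [t <= 1]; the integrand
   at [x] also involves [xi - x], in the cube of radius [2 t], whence the
   factor [2^theta]. *)
pose a : R := (c / D * (c / D) / (2 `^ theta))%R.
have cD0 : (0 < c / D)%R by exact: divr_gt0.
have a0 : (0 < a)%R by apply: divr_gt0; [exact: mulr_gt0|exact: powR_gt0].
have a20 : (0 < a / 2)%R by exact: divr_gt0.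
exists (a / 2)%R => // k xi xik.
(* Radius [2^-(i+1)] rather than [2^-i], so that [xi - x] remains in the unit
   cube, where the lower bound on the convolution holds. *)
pose t i : R := (2^-1 ^+ i.+1)%R.
pose u i : R := ((t i)^-1 ^+ n)%R.
have t0 i : (0 < t i)%R by rewrite exprn_gt0// invr_gt0.
have t1 i : (t i * 2 <= 1)%R.
  by rewrite /t exprSr -mulrA mulVf ?mulr1 ?exprn_ile1 ?invr_ge0// ?invf_le1 ?ler1n.
have u0 i : (0 <= u i)%R by rewrite exprn_ge0// invr_ge0 ltW.
have uS i : (2 * u i <= u i.+1)%R.
  rewrite /u (_ : t i.+1 = 2^-1 * t i)%R; last by rewrite /t exprS.
  rewrite invfM invrK exprMn; apply: ler_wpM2r; first exact: u0.
  by rewrite -[leLHS]expr1 ler_eXn2l// ltr1n.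
have utheta i x : (i < k)%N -> Q (t i) x ->
    (u i)%:E <= a^-1%:E * (h (xi - x)%R * h x).
  move=> ik xt; rewrite lee_pdivlMl//.
  have t20 : (0 < t i * 2)%R by rewrite mulr_gt0.
  have xixt : Q (t i * 2) (xi - x)%R.
    rewrite mulr_natr mulr2n; apply: cubeB => //; apply: le_cube xik.
    by rewrite ler_wiXn2l// ?invf_le1 ?ler1n.
  have h1 : (c / (D * t i `^ theta))%:E <= h x.
    apply: kernel_lower_bound => //; apply: hc; apply: le_cube xt.
    by have := t0 i; have := t1 i; lra.
  have h2 : (c / (D * (t i * 2) `^ theta))%:E <= h (xi - x)%R.
    by apply: kernel_lower_bound => //; apply: hc; exact: le_cube xixt.
  apply: le_trans (lee_pmul _ _ h2 h1); last 2 first.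
  - by rewrite lee_fin ltW// divr_gt0// Ds_gt0.
  - by rewrite lee_fin ltW// divr_gt0// Ds_gt0.
  have ti0 : (0 < t i `^ theta)%R by exact: powR_gt0.
  have two0 : (0 < 2 `^ theta :> R)%R by exact: powR_gt0.
  rewrite -!EFinM lee_fin.
  rewrite powRM ?(ltW (t0 i))//.
  have -> : (c / (D * (t i `^ theta * 2 `^ theta)) * (c / (D * t i `^ theta)) =
     a * (t i `^ theta * t i `^ theta)^-1)%R.
    by rewrite /a; field; rewrite (gt_eqF D_gt0) (gt_eqF ti0) (gt_eqF two0).
  rewrite ler_pM2l// /u exprVn lef_pV2 ?posrE ?(mulr_gt0 ti0 ti0) ?exprn_gt0//.
  by apply: powR_sqr_le => //; rewrite t0/=; have := t0 i; have := t1 i; lra.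
pose g (i : 'I_k) (x : lebesgue_rV R n) : \bar R :=
  (a / 2 * u i)%:E * (\1_(Q (t i)) x)%:E.
have m1 i : measurable_fun setT
    (fun x : lebesgue_rV R n => (\1_(Q (t i)) x)%:E).
  by apply/measurable_EFinP; apply: measurable_indic; exact: measurable_cube.
have mg i : measurable_fun setT (g i) by exact: measurable_funeM.
have g0 i x : 0 <= g i x.
  by rewrite mule_ge0 ?lee_fin// mulr_ge0// ltW.
have gE x : \sum_(i < k) g i x = (a / 2 * (\sum_(i < k) u i * \1_(Q (t i)) x))%:E.
  by rewrite sumEFin mulr_sumr; congr (_%:E); apply: eq_bigr => i _; rewrite mulrA.
apply: (@le_trans _ _ (\int[mu]_(x in setT) (\sum_(i < k) g i x))).
  rewrite ge0_integral_sum//.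
  rewrite (eq_bigr (fun=> (a / 2 * 2 ^+ n)%:E)); last first.
    move=> i _; rewrite ge0_integralZl//.
    - rewrite integral_indic//; last exact: measurable_cube.
      rewrite setIT lebesgue_cube ?(ltW (t0 _))// -EFinM -[(t i *+ 2)%R]mulr_natl.
      have tn0 : (t i ^+ n != 0)%R by rewrite gt_eqF// exprn_gt0.
      rewrite exprMn /u exprVn; congr (_%:E); move: tn0.
      by move: (t i ^+ n)%R (2 ^+ n)%R => tn twon tn0; field.
    - by rewrite lee_fin mulr_ge0// ltW.
  rewrite sumEFin sumr_const card_ord lee_fin -[leRHS]mulr_natr.
  rewrite -[leRHS]mulrA; apply: ler_wpM2l; first exact: ltW.
  by rewrite ler_peMl// exprn_ege1// ler1n.
apply: le_convolution => [//||x _]; first exact: emeasurable_sum.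
rewrite sume_ge0//= gE.
have := sum_indic_geometric_le R _ (fun i => Q (t i)) u
  (a^-1%:E * (h (xi - x)%R * h x)) k x u0 uS.
move=> /(_ _ (fun i ik => utheta i x ik)) /wrap[].
  by rewrite !mule_ge0// lee_fin invr_ge0 ltW.
by rewrite muleA -EFinM -invf_div lee_pdivlMl// -EFinM.
Qed.

(** Let [m] be the mass of [h] on a cube of radius [s / 2].  On the cube of
    radius [s] one has [h >= b], where [convolution_unbounded] makes
    [b s^theta] as large as desired.  Hence [b m <= h * h <= D s^theta h] on
    the small cube; integrating over it, whose volume is [s^n], and cancelling
    [m] bounds [b s^n] by [D s^theta].  The scale [s] is chosen small enough to
    violate this. *)
Lemma kernel_exponent_lt : (theta < n%:R / 2)%R.
Proof.
rewrite ltNge; apply/negP => ntheta.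
have [c c0 hc] := convolution_unbounded ntheta.
pose k := (Num.truncn (D ^+ 2 / c)).+1.
have kc : (D ^+ 2 < c * k%:R)%R by rewrite mulrC -ltr_pdivrMr// truncnS_gt.
pose s : R := (2^-1 ^+ k)%R; pose r : R := (s / 2)%R.
have s0 : (0 < s)%R by rewrite exprn_gt0// invr_gt0.
have s1 : (s <= 1)%R by rewrite exprn_ile1 ?invr_ge0// ?invf_le1 ?ler1n.
have Qrs : Q r `<=` Q s by apply: le_cube; rewrite /r; lra.
have muQ : mu (Q r) = (s ^+ n)%:E.
  by rewrite lebesgue_cube ?divr_ge0 ?ltW// mulr2n /r -splitr.
have mQ : measurable (Q r : set (lebesgue_rV R n)) by exact: measurable_cube.
have muQ_gt0 : 0 < mu (Q r) by rewrite muQ lte_fin exprn_gt0.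
pose b : R := (c * k%:R / (D * s `^ theta))%R.
have b0 : (0 < b)%R by apply: divr_gt0; [exact: mulr_gt0|exact: Ds_gt0].
have hb xi : Q s xi -> b%:E <= h xi.
  by move=> xis; apply: kernel_lower_bound => //; exact: hc.
have mhQ : measurable_fun (Q r : set (lebesgue_rV R n)) (h : lebesgue_rV R n -> \bar R).
  exact: measurable_funS mh.
pose m := \int[mu]_(x in (Q r : set (lebesgue_rV R n))) h x.
have bm xi : Q r xi -> b%:E * m <= (D * s `^ theta)%:E * h xi.
  move=> xir; apply: le_trans (kernel_bound s xi s0 (Qrs _ xir)).
  rewrite /m -ge0_integralZl// ?lee_fin ?(ltW b0)//.
  apply: le_convolution => [//||x xr]; first exact: measurable_funeM.
  rewrite mule_ge0 ?lee_fin ?(ltW b0)//=.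
  apply: lee_wpmul2r => //; apply: hb.
  by rewrite (_ : s = r + r)%R; [exact: cubeB|rewrite /r; lra].
have m0 : 0 < m.
  apply: (@lt_le_trans _ _ (\int[mu]_(x in (Q r : set (lebesgue_rV R n))) cst b%:E x)).
    by rewrite integral_cst// mule_gt0.
  by apply: ge0_le_integral => //; [move=> x _; rewrite lee_fin ltW|move=> x /Qrs/hb].
(* Evaluating [bm] where [h] is finite shows that [m] is finite. *)
have [xi xir hxi] : exists2 xi, Q r xi & h xi \is a fin_num.
  apply: contrapT => /forall2NP nfin.
  suff : mu (Q r) <= 0 by rewrite leNgt muQ_gt0.
  rewrite -h_infty; apply: le_measure; rewrite ?inE//.
    by rewrite -[X in measurable X]setTI; apply: mh => //; exact: emeasurable_set1.
  move=> x xr; have [//|/negP] := nfin x.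
  by rewrite ge0_fin_numE// -leNgt leye_eq => /eqP.
have m_fin : m \is a fin_num.
  rewrite ge0_fin_numE ?(ltW m0)//; have := bm _ xir.
  rewrite ltey; apply: contraTneq => ->.
  by rewrite gt0_muley ?lte_fin// -(fineK hxi) -EFinM leye_eq.
have : b%:E * m * mu (Q r) <= (D * s `^ theta)%:E * m.
  rewrite -[leRHS]ge0_integralZl//; last by rewrite lee_fin ltW// Ds_gt0.
  rewrite -integral_cst//; apply: ge0_le_integral.
  - exact: mQ.
  - by move=> x _; rewrite mule_ge0 ?lee_fin// ltW.
  - exact: measurable_cst.
  - exact: measurable_funeM.
  - exact: bm.
move: m0; rewrite muQ -(fineK m_fin) lte_fin -!EFinM lee_fin => m0.
rewrite mulrAC ler_pM2r// /b mulrAC ler_pdivrMr ?Ds_gt0//.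
rewrite leNgt => /negP; apply.
have -> : (D * s `^ theta * (D * s `^ theta) = D ^+ 2 * (s `^ theta * s `^ theta))%R by ring.
apply: (@le_lt_trans _ _ (D ^+ 2 * s ^+ n)%R).
  by rewrite ler_pM2l ?exprn_gt0//; apply: powR_sqr_le => //; rewrite s0.
by rewrite ltr_pM2r// exprn_gt0.
Qed.

End kernel.

Theorem theorem1 (R : realType) (n : nat) (n_ge1 : (1 <= n)%N)
  (theta : R) (theta_ge0 : 0 <= theta) (h : 'rV[R]_n -> \bar R)
  (hH : majorizing_kernel theta h) :
  theta < n%:R / 2.
Proof.
case: hH => h_gt0 [mh _ _] [B B_gt0 hh] h_infty.
exact: (kernel_exponent_lt theta B h).
Qed.
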